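(* Let $(K,<)$ be an ordered field, let $v_{\mathrm{nat}}$ be its natural valuation and let $G := v_{\mathrm{nat}}(K^\times)$. Let $H \subseteq G$ be an $\mathcal{L}_{\mathrm{og}}$-definable convex subgroup of $G$ such that $G_0 \subsetneq H$, where $G_0$ is the maximal divisible convex subgroup of $G$. Then the coarsening $\Phi_K^{-1}(H)$ of $v_{\mathrm{nat}}$ corresponding to $H$ is $\mathcal{L}_{\mathrm{or}}$-definable in $K$ (that is, its valuation ring is $\mathcal{L}_{\mathrm{or}}$-definable).
   Context: All orderings are linear. $\mathcal{L}_{\mathrm{or}} = \{+,-,\cdot,0,1,<\}$ is the language of ordered rings and $\mathcal{L}_{\mathrm{og}}=\{+,-,0,<\}$ the language of ordered groups. ''Definable'' means first-order definable with parameters from the structure. A valuation $w$ on an ordered field $(K,<)$ has valuation ring $\mathcal{O}_w=\{a \mid w(a)\ge 0\}$ and valuation ideal $\mathcal{I}_w = \{a\mid w(a)>0\}$; it is called convex if $\mathcal{O}_w$ is convex in $(K,<)$, and definable if $\mathcal{O}_w$ is definable. The natural valuation $v_{\mathrm{nat}}$ is the finest convex valuation on $(K,<)$; its valuation ring is $\{a\in K \mid |a|\le n \text{ for some } n\in\mathbb{N}\}$. The convex valuations are exactly the coarsenings of $v_{\mathrm{nat}}$. The map $\Phi_K\colon \mathcal{O}_v \mapsto v_{\mathrm{nat}}(\mathcal{O}_v\setminus\mathcal{I}_v)$ is an inclusion-preserving bijection from the set of non-trivial convex valuation rings of $K$ (those $\neq K$) to the set of proper convex subgroups of $G$, and $\Phi_K^{-1}(H)$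 is the valuation ring $\{a \in K \mid v_{\mathrm{nat}}(a) > 0 \text{ or } v_{\mathrm{nat}}(a) \in H\}$; for $H=G$ this is read as the trivial valuation ring $K$. *)

(* Defs.v *)
From HB Require Import structures.
From mathcomp Require Import all_boot all_order all_algebra.
From mathcomp Require Import classical_sets.

Set Implicit Arguments.
Unset Strict Implicit.
Unset Printing Implicit Defensive.
Import Order.TTheory GRing.Theory Num.Theory.
Local Open Scope classical_set_scope.
Local Open Scope ring_scope.

(* MathComp has no linearly ordered abelian groups: porderZmodType requires
   neither totality nor compatibility of the order with addition. *)
HB.mixin Record isLinearlyOrderedZmodule G of Num.POrderedZmodule G := {
  ozmod_le_total : total (<=%R : rel G);
  ozmod_leD2l : forall x y z : G, y <= z -> x + y <= x + z
}.

#[short(type="orderedZmodType")]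
HB.structure Definition OrderedZmodule :=
  { G of Num.POrderedZmodule G & isLinearlyOrderedZmodule G }.

(* De Bruijn variables: an assignment is a sequence of elements, and a
   quantifier pushes a new element at index 0. *)
Inductive or_term : Type :=
| OrVar of nat
| OrZero
| OrOne
| OrOpp of or_term
| OrAdd of or_term & or_term
| OrMul of or_term & or_term.

Inductive og_term : Type :=
| OgVar of nat
| OgZero
| OgOpp of og_term
| OgAdd of og_term & og_term.

Fixpoint or_eval (K : numDomainType) (e : nat -> K) (t : or_term) : K :=
  match t with
  | OrVar i => e i
  | OrZero => 0
  | OrOne => 1
  | OrOpp t1 => - or_eval e t1
  | OrAdd t1 t2 => or_eval e t1 + or_eval e t2
  | OrMul t1 t2 => or_eval e t1 * or_eval e t2
  end.

Fixpoint og_eval (G : zmodType) (e : nat -> G) (t : og_term) : G :=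
  match t with
  | OgVar i => e i
  | OgZero => 0
  | OgOpp t1 => - og_eval e t1
  | OgAdd t1 t2 => og_eval e t1 + og_eval e t2
  end.

(* Both languages have < as their only relation symbol besides equality, so
   their formulas differ only in the terms [T]. *)
Inductive formula (T : Type) : Type :=
| FEq of T & T
| FLt of T & T
| FNot of formula T
| FAnd of formula T & formula T
| FEx of formula T.

Definition push (M : Type) (x : M) (e : nat -> M) : nat -> M :=
  fun i => if i is j.+1 then e j else x.

Fixpoint holds (M : porderZmodType) (T : Type) (ev : (nat -> M) -> T -> M)
    (e : nat -> M) (f : formula T) : Prop :=
  match f with
  | FEq t u => ev e t = ev e u
  | FLt t u => ev e t < ev e u
  | FNot f1 => ~ holds ev e f1
  | FAnd f1 f2 => holds ev e f1 /\ holds ev e f2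
  | FEx f1 => exists x : M, holds ev (push x e) f1
  end.

(* The assignment [e] supplies the parameters. *)
Definition or_definable (K : numDomainType) (A : set K) : Prop :=
  exists (f : formula or_term) (e : nat -> K),
    forall x : K, A x <-> holds (or_eval (K:=K)) (push x e) f.

Definition og_definable (G : orderedZmodType) (A : set G) : Prop :=
  exists (f : formula og_term) (e : nat -> G),
    forall x : G, A x <-> holds (og_eval (G:=G)) (push x e) f.

Definition convex_set (M : porderZmodType) (A : set M) : Prop :=
  forall a b c : M, A a -> A c -> a <= b -> b <= c -> A b.

Record convex_subgroup (G : orderedZmodType) (H : set G) : Prop := {
  subgroup0 : H 0;
  subgroupD : forall g h : G, H g -> H h -> H (g + h);
  subgroupN : forall g : G, H g -> H (- g);
  subgroup_convex : convex_set H }.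

Definition divisible (G : zmodType) (H : set G) : Prop :=
  forall (n : nat) (g : G), (0 < n)%N -> H g -> exists2 h : G, H h & h *+ n = g.

Definition maximal_divisible_convex (G : orderedZmodType) (G0 : set G) : Prop :=
  [/\ convex_subgroup G0, divisible G0 &
      forall D : set G, convex_subgroup D -> divisible D ->
        G0 `<=` D -> D = G0].

(* A valuation with value group exactly G.  Its value at 0 is infinity; the
   element [v 0 : G] is a dummy that affects no definition below. *)
Record valuation (K : fieldType) (G : orderedZmodType) (v : K -> G) : Prop := {
  valuationM : forall x y : K, x != 0 -> y != 0 -> v (x * y) = v x + v y;
  valuationD : forall x y : K, x != 0 -> y != 0 -> x + y != 0 ->
    Order.min (v x) (v y) <= v (x + y);
  valuation_onto : forall g : G, exists2 x : K, x != 0 & v x = g }.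

Definition valuation_ring (K : fieldType) (G : orderedZmodType) (v : K -> G) :
    set K := [set a | a = 0 \/ 0 <= v a].

Definition convex_valuation (K : realFieldType) (G : orderedZmodType)
    (v : K -> G) : Prop := valuation v /\ convex_set (valuation_ring v).

(* The finest convex valuation, which is unique up to equivalence. *)
Definition natural_valuation (K : realFieldType) (G : orderedZmodType)
    (v : K -> G) : Prop :=
  convex_valuation v /\
  forall (G' : orderedZmodType) (w : K -> G'), convex_valuation w ->
    valuation_ring v `<=` valuation_ring w.

(* The valuation ring of the coarsening of v that corresponds to the convex
   subgroup H of its value group; 0 belongs to it because v(0) = infinity > 0. *)
Definition coarsening_ring (K : fieldType) (G : orderedZmodType) (v : K -> G)
    (H : set G) : set K := [set a | a = 0 \/ 0 < v a \/ H (v a)].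

(* Main.v *)
Require Import Defs.
From HB Require Import structures.
From mathcomp Require Import all_boot all_order all_algebra.
From mathcomp Require Import boolp classical_sets.

(* For n > 0 let G_n be the largest convex subgroup of G contained in nG.  Its
   valuation ring is definable in K without parameters: x lies outside it
   exactly when, for some b > 0 such that [b / 2 ^ n, b * 2 ^ n] contains no
   n-th power, one has x ^ 2 > 1 and the interval [b / x ^ (2 n), b * x ^ (2 n)]
   contains an n-th power.  So K interprets the ordered group G / G_n.  As H
   properly contains G_0, some h in H is not divisible by some q > 0, and then
   G_n is a subgroup of H for every multiple n of q.

   It remains to define H in G / G_n.  The value of the formula f that defines H
   involves only divisibility by finitely many integers, all dividing some N
   which is found by elimination along f.  If L is convex and N-divisible, a
   back-and-forth argument shows that the truth of f depends only on finitely
   many conditions definable in G / L and on the exact values of finitely many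
   terms, when these lie in L; the latter can be adjusted by moving elements
   within their cosets of L.  Taking for n a common multiple of N and q and
   L = G_n finishes the proof. *)

Set Implicit Arguments.
Unset Strict Implicit.
Unset Printing Implicit Defensive.
Import Order.TTheory GRing.Theory Num.Theory.
Local Open Scope classical_set_scope.
Local Open Scope ring_scope.

(** * Ordered abelian groups *)

Section OrderedGroup.
Variable G : orderedZmodType.
Implicit Types x y z g h : G.

Lemma ozmod_leP x y : x <= y \/ y <= x.
Proof. by apply/orP; exact: ozmod_le_total. Qed.

Lemma ozmod_ltNge x y : (x < y) = ~~ (y <= x).
Proof.
by rewrite (comparable_ltNge (ozmod_le_total x y)).
Qed.

Lemma ozmod_subr_ge0 x y : (0 <= y - x) = (x <= y).
Proof.
apply/idP/idP => [/(ozmod_leD2l x)|/(ozmod_leD2l (- x))].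
  by rewrite addr0 addrC subrK.
by rewrite addNr addrC.
Qed.

Lemma ozmod_leN2 x y : (- x <= - y) = (y <= x).
Proof. by rewrite -(ozmod_subr_ge0 (- x)) opprK addrC ozmod_subr_ge0. Qed.

Lemma ozmod_leBrDr x y z : (x <= y - z) = (x + z <= y).
Proof. by rewrite -ozmod_subr_ge0 -addrA -opprD ozmod_subr_ge0 (addrC z). Qed.

Lemma ozmod_leBlDr x y z : (x - z <= y) = (x <= y + z).
Proof. by rewrite -(ozmod_subr_ge0 x) -(ozmod_subr_ge0 (x - z)) opprB addrA. Qed.

Lemma ozmod_leN0 x : (- x <= 0) = (0 <= x).
Proof. by rewrite -{1}oppr0 ozmod_leN2. Qed.

Lemma ozmod_oppr_gt0 x : 0 < x -> ~ 0 < - x.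
Proof. by move=> /ltW x0; rewrite ozmod_ltNge ozmod_leN0 x0. Qed.

Lemma ozmod_leD x y z t : x <= y -> z <= t -> x + z <= y + t.
Proof.
move=> xy zt; apply: le_trans (ozmod_leD2l x _ _ zt) _.
by rewrite addrC (addrC y); exact: ozmod_leD2l.
Qed.

Lemma ozmod_mulrn_ge0 x n : 0 <= x -> 0 <= x *+ n.
Proof.
move=> x0; elim: n => // n IH.
by rewrite mulrS -[X in X <= _](addr0 0); exact: ozmod_leD.
Qed.

Lemma ozmod_le_mulrn x n : (0 < n)%N -> 0 <= x -> x <= x *+ n.
Proof.
case: n => // n _ x0; rewrite mulrS -{1}[x]addr0.
exact/ozmod_leD2l/ozmod_mulrn_ge0.
Qed.

Lemma ozmod_mulrn_eq0 x n : (0 < n)%N -> x *+ n = 0 -> x = 0.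
Proof.
move=> n0; have pos y : 0 <= y -> y *+ n = 0 -> y = 0.
  by move=> y0 yn; apply/le_anti; rewrite y0 andbT -yn ozmod_le_mulrn.
move=> xn; case: (ozmod_leP 0 x) => x0; first exact: pos.
apply: oppr_inj; rewrite oppr0; apply: pos; last by rewrite mulNrn xn oppr0.
by rewrite -ozmod_leN0 opprK.
Qed.

Lemma ozmod_mulrn_ge0_inv x n : (0 < n)%N -> 0 <= x *+ n -> 0 <= x.
Proof.
move=> n0 xn; case: (ozmod_leP 0 x) => // x0.
suff -> : x = 0 by [].
apply/(ozmod_mulrn_eq0 n0)/le_anti; rewrite xn andbT -[x]opprK mulNrn.
by rewrite ozmod_leN0 ozmod_mulrn_ge0 // -ozmod_leN0 opprK.
Qed.

Lemma ozmod_mulrz_inj (n : int) x y : n != 0 -> x *~ n = y *~ n -> x = y.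
Proof.
move=> n0 /eqP; rewrite -subr_eq0 -mulrzBl => /eqP xyn; apply/eqP.
rewrite -subr_eq0; apply/eqP; apply: (@ozmod_mulrn_eq0 _ `|n|%N).
  by rewrite absz_gt0.
case: n n0 xyn => n _ //; rewrite NegzE mulrNz => /eqP.
by rewrite oppr_eq0 => /eqP.
Qed.

Lemma subgroupB (L : set G) g h : convex_subgroup L -> L g -> L h -> L (g - h).
Proof. by move=> HL Lg Lh; apply: subgroupD => //; exact: subgroupN. Qed.

Lemma subgroupMz (L : set G) (n : int) g :
  convex_subgroup L -> L g -> L (g *~ n).
Proof.
move=> HL Lg; have LMn k : L (g *+ k).
  elim: k => [|k IH]; first by rewrite mulr0n; exact: subgroup0.
  by rewrite mulrS; exact: subgroupD.
case: n => k; first exact: LMn.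
by rewrite NegzE mulrNz; apply: subgroupN => //; exact: LMn.
Qed.

(* The largest convex subgroup of G contained in nG. *)
Definition divisible_core (n : nat) : set G :=
  [set g | forall d, 0 <= d -> d <= g \/ d <= - g -> exists h, h *+ n = d].

(** For the sum, some [0 <= d <= g + h] lies below [g], or below [h] when [g <= 0], or splits as
    [g + (d - g)] with both summands divisible by [n]. *)
Lemma divisible_core_convex n : convex_subgroup (divisible_core n).
Proof.
have N g : divisible_core n g -> divisible_core n (- g).
  move=> Lg d d0; rewrite opprK => dg; apply: Lg => //.
  by case: dg; [right|left].
have half g h d : divisible_core n g -> divisible_core n h ->
    0 <= d -> d <= g + h -> exists k, k *+ n = d.
  move=> Lg Lh d0 dgh.
  case: (ozmod_leP d g) => dg; first by apply: Lg => //; left.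
  case: (ozmod_leP 0 g) => g0; last first.
    apply: Lh => //; left; apply: le_trans dgh _.
    by rewrite -[leRHS]add0r; exact: ozmod_leD.
  have [|k1 k1E] := Lg g g0; first by left.
  have [||k2 k2E] := Lh (d - g); first by rewrite ozmod_subr_ge0.
    left; rewrite -ozmod_subr_ge0.
    by rewrite opprB addrA (addrC h) ozmod_subr_ge0.
  by exists (k1 + k2); rewrite mulrnDl k1E k2E addrC subrK.
split.
- move=> d d0; rewrite oppr0 => dle; exists 0; rewrite mul0rn.
  by apply/le_anti; rewrite d0; case: dle.
- move=> g h Lg Lh d d0 []; first exact: half.
  by rewrite opprD; apply: half => //; exact: N.
- exact: N.
- move=> a b c La Lc ab bc d d0 [db|dNb].
    by apply: Lc => //; left; exact: le_trans bc.
  by apply: La => //; right; apply: le_trans dNb _; rewrite ozmod_leN2.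
Qed.

Definition mul_divisible (L : set G) (n : nat) :=
  forall g, L g -> exists2 h, L h & h *+ n = g.

(** For [g >= 0] the quotient [h] satisfies [0 <= h <= h *+ n = g], so whatever lies below [h] lies
    below [g]. Negative elements follow by symmetry. *)
Lemma divisible_core_div n : (0 < n)%N -> mul_divisible (divisible_core n) n.
Proof.
move=> n0; have [L0 _ LN _] := divisible_core_convex n.
have pos g : divisible_core n g -> 0 <= g ->
    exists2 h, divisible_core n h & h *+ n = g.
  move=> Lg g0; have [|h hE] := Lg g g0; first by left.
  exists h => // d d0.
  have h0 : 0 <= h by apply: (ozmod_mulrn_ge0_inv n0); rewrite hE.
  move=> dh; apply: Lg => //; left; apply: (@le_trans _ _ h).
    by case: dh => // dh; apply: le_trans dh (le_trans _ h0); rewrite ozmod_leN0.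
  by rewrite -hE ozmod_le_mulrn.
move=> g Lg; case: (ozmod_leP 0 g) => g0; first exact: pos.
have [||h Lh hE] := pos (- g); [exact: LN|by rewrite -ozmod_leN0 opprK|].
by exists (- h); [exact: LN|rewrite mulNrn hE opprK].
Qed.

(** If some [g] in the core were outside [H], convexity would put all of [H] between [g] and [- g],
    making [h] or [- h] divisible by [n]. *)
Lemma divisible_core_sub (H : set G) (n : nat) h : convex_subgroup H ->
  H h -> (forall g, g *+ n <> h) -> divisible_core n `<=` H.
Proof.
move=> HH Hh hn g Lg; apply: contrapT => nHg.
have key k : H k -> 0 <= k -> exists l, l *+ n = k.
  move=> Hk k0; apply: Lg => //.
  apply: contrapT => /not_orP[/negP + /negP].
  rewrite -!ozmod_ltNge => /ltW gk /ltW Ngk; apply: nHg.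
  apply: (subgroup_convex HH) (subgroupN HH Hk) Hk _ gk.
  by rewrite -[g]opprK ozmod_leN2.
case: (ozmod_leP 0 h) => h0; first by have [l] := key h Hh h0; exact: hn.
have [||l lE] := key (- h); [exact: subgroupN|by rewrite -ozmod_leN0 opprK|].
by apply: (hn (- l)); rewrite mulNrn lE opprK.
Qed.

End OrderedGroup.

(** * Elimination modulo a divisible convex subgroup *)

Definition og_sub (t u : og_term) := OgAdd t (OgOpp u).

Definition og_scale (n : int) (t : og_term) : og_term :=
  match n with
  | Posz n => iter n (OgAdd t) OgZero
  | Negz n => OgOpp (iter n.+1 (OgAdd t) OgZero)
  end.

Lemma og_eval_sub (G : zmodType) (e : nat -> G) t u :
  og_eval e (og_sub t u) = og_eval e t - og_eval e u.
Proof. by []. Qed.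

Lemma og_eval_scale (G : zmodType) (e : nat -> G) n t :
  og_eval e (og_scale n t) = og_eval e t *~ n.
Proof.
have E k : og_eval e (iter k (OgAdd t) OgZero) = og_eval e t *+ k.
  by elim: k => //= k ->; rewrite mulrS.
by case: n => n; rewrite /og_scale; [|rewrite NegzE mulrNz -pmulrn -E].
Qed.

(** A term is an integer linear form: this is its coefficient at the newest variable, and [og_rest]
    is the remaining form, reindexed for the assignment before the push. *)
Fixpoint og_lead (t : og_term) : int :=
  match t with
  | OgVar i => (i == 0)%N
  | OgZero => 0
  | OgOpp t1 => - og_lead t1
  | OgAdd t1 t2 => og_lead t1 + og_lead t2
  end.

Fixpoint og_rest (t : og_term) : og_term :=
  match t with
  | OgVar i => if i is j.+1 then OgVar j else OgZero
  | OgZero => OgZero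
  | OgOpp t1 => OgOpp (og_rest t1)
  | OgAdd t1 t2 => OgAdd (og_rest t1) (og_rest t2)
  end.

Lemma og_eval_push (G : zmodType) (g : G) (e : nat -> G) t :
  og_eval (push g e) t = g *~ og_lead t + og_eval e (og_rest t).
Proof.
elim: t => [[|i]||t IH|t IHt u IHu] /=; rewrite ?mulr1z ?mulr0z ?addr0 ?add0r //.
  by rewrite IH mulrNz opprD.
by rewrite IHt IHu mulrzDr addrACA.
Qed.

Section BackAndForth.
Variable G : orderedZmodType.
Implicit Types (L : set G) (e : nat -> G) (f : formula og_term).

(* Predicates on assignments that depend only on the images in G / L, and are
   closed under first-order definability in the ordered group G / L. *)
Record residue_class L (D : ((nat -> G) -> Prop) -> Prop) : Prop := {
  residue_inv : forall P, D P -> forall e e', (forall i, L (e i - e' i)) ->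
    P e -> P e';
  residue_ext : forall P Q, (forall e, P e <-> Q e) -> D P -> D Q;
  residue_not : forall P, D P -> D (fun e => ~ P e);
  residue_and : forall P Q, D P -> D Q -> D (fun e => P e /\ Q e);
  residue_ex : forall P, D P -> D (fun e => exists g, P (push g e));
  residue_mem : forall t, D (fun e => L (og_eval e t));
  residue_pos : forall t, D (fun e => 0 < og_eval e t /\ ~ L (og_eval e t)) }.

(** * Finite partitions into residue cells *)

Section ResidueClass.
Variables (L : set G) (D : ((nat -> G) -> Prop) -> Prop).
Hypothesis HL : convex_subgroup L.
Hypothesis HD : residue_class L D.

Lemma residue_true : D (fun=> True).
Proof.
apply: (residue_ext HD) (residue_mem HD OgZero) => e; split => // _.
exact: subgroup0.
Qed.

Lemma residue_or P Q : D P -> D Q -> D (fun e => P e \/ Q e).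
Proof.
move=> DP DQ; apply: (residue_ext HD) (residue_not HD
  (residue_and HD (residue_not HD DP) (residue_not HD DQ))) => e.
by rewrite -not_orE notK.
Qed.

Lemma residue_const (b : Prop) : D (fun=> b).
Proof.
have [hb|nb] := pselect b.
  by apply: (residue_ext HD) residue_true.
by apply: (residue_ext HD) (residue_not HD residue_true).
Qed.

Lemma residue_all (I : finType) (P : I -> (nat -> G) -> Prop) :
  (forall i, D (P i)) -> D (fun e => forall i, P i e).
Proof.
move=> DP; have {}DP (s : seq I) : D (fun e => {in s, forall i, P i e}).
  elim: s => [|i s IH]; first by apply: (residue_ext HD) residue_true.
  apply: (residue_ext HD) (residue_and HD (DP i) IH) => e; split.
    by move=> [Pi Ps] j; rewrite inE => /predU1P[->//|]; exact: Ps.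
  move=> Ps; split; first by apply: Ps; rewrite mem_head.
  by move=> j js; apply: Ps; rewrite inE js orbT.
apply: (residue_ext HD) (DP (enum I)) => e.
by split=> [Pe i|Pe i _ //]; apply: Pe; rewrite mem_enum.
Qed.

(** [E] need not be an equivalence: it only has to hold inside each cell of some finite colouring
    [c] whose cells belong to [D]. *)
Definition finitely_refined (E : (nat -> G) -> (nat -> G) -> Prop) :=
  exists (I : finType) (c : (nat -> G) -> I),
    (forall i, D (fun e => c e = i)) /\ (forall e e', c e = c e' -> E e e').

Lemma finitely_refined_sub (E F : (nat -> G) -> (nat -> G) -> Prop) :
  (forall e e', E e e' -> F e e') -> finitely_refined E -> finitely_refined F.
Proof.
by move=> EF [I [c [Dc cE]]]; exists I, c; split=> // e e' /cE; exact: EF.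
Qed.

Lemma finitely_refined_sym E :
  finitely_refined E -> finitely_refined (fun e e' => E e' e).
Proof. by move=> [I [c [Dc cE]]]; exists I, c; split=> // e e' /esym/cE. Qed.

Lemma finitely_refined_and E F : finitely_refined E -> finitely_refined F ->
  finitely_refined (fun e e' => E e e' /\ F e e').
Proof.
move=> [I [c [Dc cE]]] [J [d [Dd dF]]].
exists (I * J)%type, (fun e => (c e, d e)); split=> [[i j]|e e' [/cE ? /dF ?]//].
apply: (residue_ext HD) (residue_and HD (Dc i) (Dd j)) => e.
by split=> [[-> ->]|[-> ->]].
Qed.

(** The colour is the vector of truth values; each cell is a finite conjunction of the predicates
    and their negations. *)
Lemma finitely_refined_preds (I : finType) (P : I -> (nat -> G) -> Prop) :
  (forall i, D (P i)) ->
  finitely_refined (fun e e' => forall i, P i e <-> P i e').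
Proof.
move=> DP; exists {ffun I -> bool}, (fun e => [ffun i => `[< P i e >]]).
split=> [f|e e' /ffunP ee' i].
  apply: (residue_ext HD) (residue_all (P := fun i e => P i e /\ f i \/
    ~ P i e /\ ~ f i) _) => [e|i]; last first.
    by apply: residue_or; apply: (residue_and HD) (residue_const _) => //;
      exact: (residue_not HD).
  split=> [Pf|<- i]; last by rewrite ffunE; case: asboolP => ?; [left|right].
  apply/ffunP => i; rewrite ffunE; case: (Pf i) => -[Pi fi].
    by rewrite fi asboolT.
  by rewrite asboolF //; apply/esym/negbTE/negP.
by apply: asbool_eq_equiv; have := ee' i; rewrite !ffunE.
Qed.

Lemma finitely_refined_pred P : D P ->
  finitely_refined (fun e e' => P e <-> P e').
Proof.
move=> DP; apply: finitely_refined_sub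
  (@finitely_refined_preds unit (fun=> P) (fun=> DP)) => e e'; exact.
Qed.

(** This is the back-and-forth step. Assignments are classified by the set of colours their
    one-point extensions realise, and there are finitely many such sets. *)
Lemma finitely_refined_ex E : finitely_refined E ->
  finitely_refined (fun e e' => forall g, exists g', E (push g e) (push g' e')).
Proof.
move=> [I [c [Dc cE]]]; apply: finitely_refined_sub
  (@finitely_refined_preds I (fun i e => exists g, c (push g e) = i)
     (fun i => residue_ex HD (Dc i))) => e e' cee' g.
have [|g' g'E] := (cee' (c (push g e))).1; first by exists g.
by exists g'; exact: cE.
Qed.

End ResidueClass.

(** * Elimination of one variable *)

Definition agree L (I : Type) (T : I -> og_term) e e' := forall i,
  L (og_eval e (T i)) \/ L (og_eval e' (T i)) ->
  og_eval e (T i) = og_eval e' (T i).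

Definition mem_equiv L (I : Type) (T : I -> og_term) e e' := forall i,
  L (og_eval e (T i)) <-> L (og_eval e' (T i)).

(** The pairs give the combination of [T i] and [T j] in which the leading coefficients cancel, so
    that only the rests remain; the single indices serve terms free of the variable. *)
Definition elim_terms (I : Type) (T : I -> og_term) (k : I + I * I) : og_term :=
  match k with
  | inl i => og_rest (T i)
  | inr (i, j) => og_sub (og_scale (og_lead (T i)) (og_rest (T j)))
                         (og_scale (og_lead (T j)) (og_rest (T i)))
  end.

(** Zero coefficients count as 1, so the product is positive and still a multiple of each nonzero
    leading coefficient. *)
Definition elim_index (I : finType) (T : I -> og_term) : nat :=
  \prod_i (if og_lead (T i) == 0 then 1%N else `|og_lead (T i)|%N).

Lemma elim_index_gt0 (I : finType) (T : I -> og_term) : (0 < elim_index T)%N.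
Proof.
by rewrite /elim_index prodn_gt0 // => i; case: eqP => // /eqP; rewrite absz_gt0.
Qed.

Lemma mul_divisible_dvd L n m : convex_subgroup L -> (n %| m)%N ->
  mul_divisible L m -> mul_divisible L n.
Proof.
move=> HL /dvdnP[k ->] Lm g /Lm[h Lh <-].
exists (h *+ k); last by rewrite mulrnA.
exact: (subgroupMz k).
Qed.

(* When some term pins g down modulo L up to an n-fold multiple, the
   n-divisibility of L allows one to shift g' within its coset so that this
   term takes the same value at both assignments; the other terms then follow
   by eliminating the first variable. *)
Lemma agree_extend L (I : finType) (T : I -> og_term) e e' g g' :
  convex_subgroup L -> mul_divisible L (elim_index T) ->
  mem_equiv L T (push g e) (push g' e') -> agree L (elim_terms T) e e' ->
  exists2 l, L l & agree L T (push g e) (push (g' + l) e').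
Proof.
move=> HL Ldiv Teq Tag.
(* A shift by [l] in [L] changes every term by a multiple of [l], so values in [L] stay in [L] and
   only one half of the agreement has to be shown. *)
have shift l i : L l -> L (og_eval (push (g' + l) e') (T i)) ->
    L (og_eval (push g e) (T i)).
  move=> Ll; rewrite Teq !og_eval_push mulrzDl => Lx.
  have := subgroupB HL Lx (subgroupMz (og_lead (T i)) HL Ll).
  by rewrite addrAC addrK.
suff [l Ll lE] : exists2 l, L l & forall i, L (og_eval (push g e) (T i)) ->
    og_eval (push g e) (T i) = og_eval (push (g' + l) e') (T i).
  by exists l => // i [|/(shift _ _ Ll)]; exact: lE.
have [[i [n0 Li]]|none] := pselect (exists i, og_lead (T i) != 0 /\
    L (og_eval (push g e) (T i))); last first.
  exists 0; first exact: subgroup0.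
  move=> i Li; have n0 : og_lead (T i) = 0.
    by apply/eqP/negPn/negP => n0; apply: none; exists i.
  move: Li; rewrite !og_eval_push n0 !mulr0z !add0r => Li.
  by apply: (Tag (inl i)); left.
have Li' := (Teq i).1 Li.
have Ldn : mul_divisible L `|og_lead (T i)|%N.
  apply: mul_divisible_dvd Ldiv => //; rewrite /elim_index (bigD1 i) //=.
  by rewrite (negbTE n0) dvdn_mulr.
have [l Ll lE] : exists2 l, L l & l *~ og_lead (T i) =
    og_eval (push g e) (T i) - og_eval (push g' e') (T i).
  have [l Ll lE] := Ldn _ (subgroupB HL Li Li').
  case: (og_lead (T i)) n0 lE => n _ lE; first by exists l.
  exists (- l); first exact: subgroupN.
  by rewrite NegzE mulrNz mulNrz opprK -lE.
have iE : og_eval (push g e) (T i) = og_eval (push (g' + l) e') (T i).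
  move: lE; rewrite !og_eval_push mulrzDl => ->.
  by rewrite addrAC addrC subrK.
(* Once the values of [T i] coincide, this identity determines the multiple of [T j] by the nonzero
   lead of [T i]; torsion-freeness then gives [T j] itself. *)
have elimE (h : G) d j :
    og_eval (push h d) (T j) *~ og_lead (T i) =
    og_eval (push h d) (T i) *~ og_lead (T j) +
      og_eval d (elim_terms T (inr (i, j))).
  rewrite !og_eval_push /= !og_eval_scale !mulrzDl -!mulrzA.
  by rewrite (mulrC (og_lead (T j))) -addrA; congr (_ + _); rewrite addrC subrK.
exists l => // j Lj; apply: (ozmod_mulrz_inj n0).
rewrite !elimE -iE; congr (_ + _); apply: (Tag (inr (i, j))); left.
have := subgroupB HL (subgroupMz (og_lead (T i)) HL Lj)
  (subgroupMz (og_lead (T j)) HL Li).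
by rewrite elimE addrAC subrr add0r.
Qed.

(** [T] and [N] depend on [f] alone: [L] is chosen afterwards, as a core for a multiple of [N]. *)
Lemma holds_residue f : exists (I : finType) (T : I -> og_term) (N : nat),
  (0 < N)%N /\
  forall L D, convex_subgroup L -> mul_divisible L N -> residue_class L D ->
    exists2 E, finitely_refined D E &
      forall e e', E e e' -> agree L T e e' ->
        holds (og_eval (G:=G)) e f <-> holds (og_eval (G:=G)) e' f.
Proof.
elim: f => [t u|t u|f IH|f1 IH1 f2 IH2|f IH].
- exists unit, (fun=> og_sub t u), 1%N; split=> // L D HL _ HD.
  exists (mem_equiv L (fun _ : unit => og_sub t u)).
    by apply: (finitely_refined_preds HL HD) => // _; exact: (residue_mem HD).
  move=> e e' Lee' /(_ tt) ag /=.
  have zero (d : nat -> G) : og_eval d t = og_eval d u <->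
      og_eval d (og_sub t u) = 0.
    by rewrite og_eval_sub; split=> [->|/eqP]; rewrite ?subrr// subr_eq0 => /eqP.
  rewrite !zero; split=> E0; first by rewrite -ag // E0; left; exact: subgroup0.
  by rewrite ag // E0; right; exact: subgroup0.
(* Outside [L] the sign of [u - t] is a condition on residues; inside [L] the agreement of exact
   values decides it. *)
- exists unit, (fun=> og_sub u t), 1%N; split=> // L D HL _ HD.
  exists (fun e e' => mem_equiv L (fun _ : unit => og_sub u t) e e' /\
     (0 < og_eval e (og_sub u t) /\ ~ L (og_eval e (og_sub u t)) <->
      0 < og_eval e' (og_sub u t) /\ ~ L (og_eval e' (og_sub u t)))).
    apply: (finitely_refined_and HD) => //.
      by apply: (finitely_refined_preds HL HD) => // _; exact: (residue_mem HD).
    by apply: (finitely_refined_pred HL HD) => //; exact: (residue_pos HD).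
  move=> e e' [/(_ tt) Lee' pos] /(_ tt) ag /=.
  have zero (d : nat -> G) : og_eval d t < og_eval d u <->
      0 < og_eval d (og_sub u t).
    rewrite og_eval_sub !ozmod_ltNge -[X in ~~ (X <= 0)]opprB ozmod_leN0.
    by rewrite ozmod_subr_ge0.
  rewrite !zero; have [Le|nLe] := pselect (L (og_eval e (og_sub u t))).
    by rewrite ag //; left.
  have nLe' : ~ L (og_eval e' (og_sub u t)) by rewrite -Lee'.
  by split=> P; [apply: (pos.1 _).1|apply: (pos.2 _).1].
- have [I [T [N [N0 H]]]] := IH; exists I, T, N; split=> // L D HL LN HD.
  have [E ED EH] := H L D HL LN HD; exists E => // e e' Eee' ag /=.
  by rewrite (EH _ _ Eee' ag).
- have [I1 [T1 [N1 [N10 H1]]]] := IH1; have [I2 [T2 [N2 [N20 H2]]]] := IH2.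
  exists (I1 + I2)%type,
    (fun i => match i with inl i => T1 i | inr i => T2 i end), (N1 * N2)%N.
  split=> [|L D HL LN HD]; first by rewrite muln_gt0 N10.
  have LN1 := mul_divisible_dvd HL (dvdn_mulr N2 (dvdnn N1)) LN.
  have LN2 := mul_divisible_dvd HL (dvdn_mull N1 (dvdnn N2)) LN.
  have [E1 ED1 EH1] := H1 L D HL LN1 HD.
  have [E2 ED2 EH2] := H2 L D HL LN2 HD.
  exists (fun e e' => E1 e e' /\ E2 e e'); first exact: (finitely_refined_and HD).
  move=> e e' [E1ee' E2ee'] ag /=.
  rewrite (EH1 _ _ E1ee' (fun i => ag (inl i))).
  by rewrite (EH2 _ _ E2ee' (fun i => ag (inr i))).
have [I [T [N [N0 H]]]] := IH.
(* The factor [N] serves the subformula, [elim_index T] the shift of the witness. *)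
exists (I + I * I)%type, (elim_terms T), (N * elim_index T)%N.
split=> [|L D HL LN HD]; first by rewrite muln_gt0 N0 elim_index_gt0.
have [E ED EH] := H L D HL (mul_divisible_dvd HL (dvdn_mulr _ (dvdnn _)) LN) HD.
have Ldiv := mul_divisible_dvd HL (dvdn_mull N (dvdnn (elim_index T))) LN.
have [J [c [Dc cE]]] :
    finitely_refined D (fun e e' => E e e' /\ mem_equiv L T e e').
  apply: (finitely_refined_and HD) => //.
  by apply: (finitely_refined_preds HL HD) => // i; exact: (residue_mem HD).
have Dceq : finitely_refined D (fun e e' => c e = c e') by exists J, c.
exists (fun e e' => (forall g, exists g', c (push g e) = c (push g' e')) /\
                    (forall g, exists g', c (push g e') = c (push g' e))).
  apply: (finitely_refined_and HD); first exact: (finitely_refined_ex HL HD Dceq).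
  exact/finitely_refined_sym/(finitely_refined_ex HL HD Dceq).
have half e e' : (forall g, exists g', c (push g e) = c (push g' e')) ->
    agree L (elim_terms T) e e' ->
    holds (og_eval (G:=G)) e (FEx f) -> holds (og_eval (G:=G)) e' (FEx f).
  move=> cee' ag [g fg]; have [g' gg'] := cee' g.
  have [l Ll lag] := agree_extend HL Ldiv (cE _ _ gg').2 ag.
  (* The shifted witness keeps the colour of [g'], because cells are invariant under [L]. *)
  exists (g' + l); apply/(EH (push g e) _ _ lag).1 => //.
  apply: (cE _ _ _).1; rewrite gg'; apply/esym.
  apply: (residue_inv HD (Dc (c (push g' e')))) (erefl _) => -[|i] /=.
    by rewrite opprD addrA subrr add0r; exact: subgroupN.
  by rewrite subrr; exact: subgroup0.
move=> e e' [ee' e'e] ag; split; apply: half => // i.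
by move=> Li; apply/esym/ag; case: Li; [right|left].
Qed.

(* The assignment of parameters agrees with itself, so the extension step shows
   that a set invariant under L is a finite union of definable cells. *)
Lemma definable_residue f : exists2 N : nat, (0 < N)%N &
  forall L D, convex_subgroup L -> mul_divisible L N -> residue_class L D ->
    forall (e : nat -> G) (H : set G), (forall g l, H g -> L l -> H (g + l)) ->
      (forall g, H g <-> holds (og_eval (G:=G)) (push g e) f) ->
    exists2 P, D P & forall g, H g <-> P (push g e).
Proof.
have [I [T [N [N0 HT]]]] := holds_residue f.
exists (N * elim_index T)%N => [|L D HL LN HD e H Hinv Hf].
  by rewrite muln_gt0 N0 elim_index_gt0.
have [E ED EH] := HT L D HL (mul_divisible_dvd HL (dvdn_mulr _ (dvdnn _)) LN) HD.
have Ldiv := mul_divisible_dvd HL (dvdn_mull N (dvdnn (elim_index T))) LN.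
have [J [c [Dc cE]]] :
    finitely_refined D (fun e e' => E e e' /\ mem_equiv L T e e').
  apply: (finitely_refined_and HD) => //.
  by apply: (finitely_refined_preds HL HD) => // i; exact: (residue_mem HD).
(* The parameters [d] and [e] must share the colour of an extension of [e] by a member of [H]. The
   existential over colours is written with negations to stay within the closure rules of [D]. *)
exists (fun d => ~ forall j, ~ (c d = j /\ exists2 g, H g & c (push g e) = j)).
  apply: (residue_not HD); apply: (residue_all HL HD) => j.
  apply: (residue_not HD); apply: (residue_and HD) => //.
  exact: (residue_const HL HD).
move=> g; split=> [Hg /(_ (c (push g e)))|]; first by apply; split=> //; exists g.
move=> /existsNP[j /contrapT[cg [h Hh ch]]].
have [l Ll ag] : exists2 l, L l & agree L T (push h e) (push (g + l) e).
  apply: agree_extend => //; apply: (cE _ _ _).2; by rewrite ch cg.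
have Ehg : E (push h e) (push (g + l) e).
  apply: (cE _ _ _).1; rewrite ch -cg; apply/esym.
  apply: (residue_inv HD (Dc (c (push g e)))) (erefl _) => -[|i] /=.
    by rewrite opprD addrA subrr add0r; exact: subgroupN.
  by rewrite subrr; exact: subgroup0.
have Hgl : H (g + l) by rewrite Hf -(EH _ _ Ehg ag) -Hf.
by have := Hinv _ _ Hgl (subgroupN HL Ll); rewrite addrK.
Qed.

End BackAndForth.

(** * The natural valuation *)

Section ArchimedeanClasses.
Local Open Scope quotient_scope.
Variable K : realFieldType.

(** On positive elements the archimedean classes form a group under multiplication; signs are later
    removed by absolute values. *)
Definition positive := {x : K | 0 < x}.
HB.instance Definition _ := Choice.on positive.

Definition arch_le (x y : K) : bool := `[< exists n : nat, x <= n%:R * y >].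

Lemma arch_leW (x y : K) : x <= y -> arch_le x y.
Proof. by move=> xy; apply/asboolP; exists 1%N; rewrite mul1r. Qed.

Lemma arch_le_trans (y x z : K) : arch_le x y -> arch_le y z -> arch_le x z.
Proof.
move=> /asboolP[n xny] /asboolP[m ymz]; apply/asboolP; exists (n * m)%N.
by rewrite (le_trans xny)// natrM -mulrA ler_wpM2l.
Qed.

Lemma arch_le_mul (x y z t : K) : 0 <= y -> 0 <= z ->
  arch_le x y -> arch_le z t -> arch_le (x * z) (y * t).
Proof.
move=> y0 z0 /asboolP[n xny] /asboolP[m zmt]; apply/asboolP; exists (n * m)%N.
rewrite natrM mulrACA (le_trans (ler_wpM2r z0 xny))// ler_wpM2l//.
by rewrite mulr_ge0.
Qed.

Definition arch_eq (x y : positive) :=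
  arch_le (val x) (val y) && arch_le (val y) (val x).

Lemma arch_eq_equiv : equiv_class_of arch_eq.
Proof.
split=> [x|x y|y x z]; first by rewrite /arch_eq arch_leW.
  by rewrite /arch_eq andbC.
move=> /andP[a b] /andP[c d].
by rewrite /arch_eq (arch_le_trans a c) (arch_le_trans d b).
Qed.

Canonical arch_equiv := EquivRelPack arch_eq_equiv.

Definition arch_class := {eq_quot arch_equiv}.
HB.instance Definition _ := Choice.on arch_class.
HB.instance Definition _ := EqQuotient.on arch_class.

Definition pos_mul (x y : positive) : positive :=
  Sub (val x * val y) (mulr_gt0 (valP x) (valP y)).
Lemma pos_inv_subproof (x : positive) : 0 < (val x)^-1.
Proof. by rewrite invr_gt0 (valP x). Qed.
Definition pos_inv (x : positive) : positive :=
  Sub (val x)^-1 (pos_inv_subproof x).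
Definition pos_one : positive := Sub 1 ltr01.

Definition arch_add (a b : arch_class) : arch_class :=
  \pi_arch_class (pos_mul (repr a) (repr b)).
Definition arch_opp (a : arch_class) : arch_class := \pi_arch_class (pos_inv (repr a)).
Definition arch_zero : arch_class := \pi_arch_class pos_one.

Lemma arch_reprP (x : positive) : arch_eq x (repr (\pi_arch_class x)).
Proof. by apply/eqmodP; rewrite reprK. Qed.

Lemma arch_piP (x y : positive) :
  reflect (\pi_arch_class x = \pi_arch_class y) (arch_eq x y).
Proof. exact: (@eqquotP _ _ arch_class). Qed.

Lemma arch_addE (x y : positive) :
  arch_add (\pi_arch_class x) (\pi_arch_class y) =
  \pi_arch_class (pos_mul x y).
Proof.
apply/esym/arch_piP.
have /andP[x1 x2] := arch_reprP x; have /andP[y1 y2] := arch_reprP y.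
by rewrite /arch_eq /= !arch_le_mul // ltW // (valP _).
Qed.

Lemma arch_addC : commutative arch_add.
Proof.
elim/quotW=> x; elim/quotW=> y; rewrite !arch_addE; congr (\pi_arch_class _).
by apply/val_inj; rewrite /= mulrC.
Qed.

Lemma arch_addA : associative arch_add.
Proof.
elim/quotW=> x; elim/quotW=> y; elim/quotW=> z.
rewrite (arch_addE y z) (arch_addE x y) !arch_addE; congr (\pi_arch_class _).
by apply/val_inj; rewrite /= mulrA.
Qed.

Lemma arch_add0 : left_id arch_zero arch_add.
Proof.
elim/quotW=> x; rewrite arch_addE; congr (\pi_arch_class _).
by apply/val_inj; rewrite /= mul1r.
Qed.

Lemma arch_addN : left_inverse arch_zero arch_opp arch_add.
Proof.
move=> a; rewrite -{2}[a]reprK arch_addE; congr (\pi_arch_class _).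
by apply/val_inj; rewrite /= mulVf // gt_eqF // (valP _).
Qed.

HB.instance Definition _ :=
  GRing.isZmodule.Build arch_class arch_addA arch_addC arch_add0 arch_addN.

(* The order of archimedean classes is reversed: large elements have small
   value. *)
Definition arch_cle (a b : arch_class) := arch_le (val (repr b)) (val (repr a)).

Lemma arch_cle_refl : reflexive arch_cle.
Proof. by move=> a; exact: arch_leW. Qed.
Lemma arch_cle_anti : antisymmetric arch_cle.
Proof.
move=> a b /andP[ab ba]; rewrite -[a]reprK -[b]reprK; apply/arch_piP.
by apply/andP.
Qed.
Lemma arch_cle_trans : transitive arch_cle.
Proof. by move=> b a c ab bc; exact: arch_le_trans bc ab. Qed.

HB.instance Definition _ := Order.isPOrder.Build ring_display arch_class
  (fun _ _ => erefl) arch_cle_refl arch_cle_anti arch_cle_trans.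

Lemma arch_class_leE (x y : positive) :
  ((\pi_arch_class x : arch_class) <= \pi_arch_class y) = arch_le (val y) (val x).
Proof.
have /andP[x1 x2] := arch_reprP x; have /andP[y1 y2] := arch_reprP y.
apply/idP/idP => h.
  exact: (arch_le_trans y1 (arch_le_trans h x2)).
exact: (arch_le_trans y2 (arch_le_trans h x1)).
Qed.

Lemma arch_class_total : total (<=%R : rel arch_class).
Proof.
elim/quotW=> x; elim/quotW=> y; rewrite !arch_class_leE.
by case: (lerP (val x) (val y)) => [|/ltW] /arch_leW ->; rewrite ?orbT.
Qed.

Lemma arch_class_leD2l (a b c : arch_class) : b <= c -> a + b <= a + c.
Proof.
elim/quotW: a => x; elim/quotW: b => y; elim/quotW: c => z.
rewrite /GRing.add /= !arch_addE !arch_class_leE => h.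
by apply: arch_le_mul h; rewrite ?arch_leW // ltW // (valP _).
Qed.

HB.instance Definition _ :=
  isLinearlyOrderedZmodule.Build arch_class arch_class_total arch_class_leD2l.

(** At 0 the default [pos_one] yields the dummy value 0. *)
Definition arch_val (x : K) : arch_class := \pi_arch_class (insubd pos_one `|x|).

Lemma val_insub_pos (x : K) : x != 0 -> val (insubd pos_one `|x|) = `|x|.
Proof. by move=> x0; rewrite val_insubd normr_gt0 x0. Qed.

Lemma arch_val_le (x y : K) : x != 0 -> y != 0 ->
  (arch_val x <= arch_val y) = arch_le `|y| `|x|.
Proof. by move=> x0 y0; rewrite arch_class_leE !val_insub_pos. Qed.

Lemma arch_val_ge0 (x : K) : x != 0 -> (0 <= arch_val x) = arch_le `|x| 1.
Proof. by move=> x0; rewrite arch_class_leE val_insub_pos. Qed.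

Lemma arch_valuation : valuation arch_val.
Proof.
split.
- move=> x y x0 y0; rewrite /GRing.add /= arch_addE; congr (\pi_arch_class _).
  apply/val_inj; rewrite /= !val_insub_pos ?mulf_neq0 //.
  by rewrite normrM.
- move=> x y x0 y0 xy0.
  (* The larger summand [s] dominates: [|s + t| <= 2 |s|]. *)
  have key (s t : K) : s != 0 -> t != 0 -> s + t != 0 -> `|t| <= `|s| ->
      arch_val s <= arch_val (s + t).
    move=> s0 t0 st0 ts; rewrite arch_val_le //; apply/asboolP; exists 2%N.
    by rewrite (le_trans (ler_normD _ _))// mulr_natl mulr2n lerD2l.
  rewrite (comparable_ge_min _ (arch_class_total _ _)).
  case: (lerP `|y| `|x|) => [yx|/ltW xy].
    by rewrite key.
  by rewrite [x + y]addrC orbC key // addrC.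
- move=> a; exists (val (repr a)); first by rewrite gt_eqF // (valP _).
  rewrite /arch_val -[RHS]reprK; congr (\pi_arch_class _); apply/val_inj.
  by rewrite val_insub_pos ?gtr0_norm ?(valP (repr a)) // gt_eqF // (valP (repr a)).
Qed.

Lemma arch_valuation_ringE (x : K) :
  valuation_ring arch_val x <-> exists n : nat, `|x| <= n%:R.
Proof.
rewrite /valuation_ring /=; split=> [[->|]|[n xn]].
- by exists 0%N; rewrite normr0.
- have [->|x0] := eqVneq x 0; first by exists 0%N; rewrite normr0.
  by rewrite arch_val_ge0 // => /asboolP[n]; rewrite mulr1; exists n.
- have [->|x0] := eqVneq x 0; [by left|right].
  by rewrite arch_val_ge0 //; apply/asboolP; exists n; rewrite mulr1.
Qed.

Lemma arch_convex_valuation : convex_valuation arch_val.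
Proof.
split; first exact: arch_valuation.
move=> a b c /arch_valuation_ringE[n an] /arch_valuation_ringE[m cm] ab bc.
apply/arch_valuation_ringE; exists (n + m)%N; rewrite natrD ler_norml.
rewrite (le_trans bc (le_trans (ler_norm c) (le_trans cm _))) ?lerDr //.
move: an; rewrite ler_norml => /andP[na _].
by rewrite (le_trans _ (le_trans na ab)) // lerN2 lerDl.
Qed.

End ArchimedeanClasses.

(** Minimality of the natural valuation ring is applied to the valuation by archimedean classes,
    whose ring consists of the elements bounded by an integer. *)
Lemma natural_valuation_bounded (K : realFieldType) (G : orderedZmodType)
    (v : K -> G) (x : K) :
  natural_valuation v -> 0 <= v x -> exists n : nat, `|x| <= n%:R.
Proof.
move=> [_ /(_ _ _ (arch_convex_valuation K)) vsub] vx.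
by apply/arch_valuation_ringE; apply: vsub; right.
Qed.

(** * Definability in the field *)

Section ConvexValuation.
Variables (K : realFieldType) (G : orderedZmodType) (v : K -> G).
Hypothesis hv : convex_valuation v.
Implicit Types x y b c : K.

Let vM x y : x != 0 -> y != 0 -> v (x * y) = v x + v y.
Proof. exact: (valuationM hv.1). Qed.

Lemma valuation1 : v 1 = 0.
Proof.
by apply: (addrI (v 1)); rewrite -vM ?oner_eq0 // mulr1 addr0.
Qed.

Lemma valuationX x n : x != 0 -> v (x ^+ n) = v x *+ n.
Proof.
move=> x0; elim: n => [|n IH]; first by rewrite expr0 valuation1.
by rewrite exprS vM ?expf_neq0 // IH mulrS.
Qed.

Lemma valuationV x : x != 0 -> v x^-1 = - v x.
Proof.
move=> x0; apply/eqP; rewrite -addr_eq0 -vM ?invr_eq0 // mulVf //.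
by rewrite valuation1.
Qed.

(** The value of -1 vanishes because its double is the value of 1 and [G] is torsion-free. *)
Lemma valuation_norm x : x != 0 -> v `|x| = v x.
Proof.
move=> x0; have vx : v (- x) = v x.
  rewrite -mulN1r vM ?oppr_eq0 ?oner_eq0 //.
  suff -> : v (- 1) = 0 by rewrite add0r.
  apply: (@ozmod_mulrn_eq0 _ _ 2) => //.
  by rewrite -valuationX ?oppr_eq0 ?oner_eq0 // sqrrN expr1n valuation1.
by case: (ger0P x).
Qed.

Lemma valuation_le x y : 0 < x -> x <= y -> v y <= v x.
Proof.
move=> x0 xy; have y0 : 0 < y := lt_le_trans x0 xy.
have : valuation_ring v (x / y).
  apply: (hv.2 0 (x / y) 1); [by left| |by rewrite divr_ge0 // ltW|].
    by right; rewrite valuation1.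
  by rewrite ler_pdivrMr // mul1r.
case=> [/eqP|]; first by rewrite gt_eqF // divr_gt0.
by rewrite vM ?invr_eq0 ?gt_eqF // valuationV ?gt_eqF // ozmod_subr_ge0.
Qed.

Lemma valuation2 : v 2 = 0.
Proof.
apply/le_anti/andP; split; first by rewrite -valuation1 valuation_le // ler1n.
rewrite -[2]/(1 + 1 : K).
have := valuationD hv.1 (oner_neq0 K) (oner_neq0 K); rewrite minxx valuation1.
by apply; rewrite (_ : 1 + 1 = 2%:R) ?pnatr_eq0.
Qed.

Lemma valuation_onto_pos g : exists2 b, 0 < b & v b = g.
Proof.
have [x x0 <-] := valuation_onto hv.1 g.
by exists `|x|; rewrite ?normr_gt0 // valuation_norm.
Qed.

End ConvexValuation.

(* The interval [b / y ^ n, b * y ^ n] meets the n-th powers. *)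
Definition near_power (K : realFieldType) (n : nat) (b y : K) : Prop :=
  exists c : K, 0 < c /\ b <= (c * y) ^+ n /\ c ^+ n <= b * y ^+ n.

Lemma near_power_le (K : realFieldType) n (b y z : K) : 0 < b -> 0 <= y -> y <= z ->
  near_power n b y -> near_power n b z.
Proof.
move=> b0 y0 yz [c [c0 [bc cb]]]; exists c; split=> //; split.
  apply: le_trans bc _.
  rewrite lerXn2r ?nnegrE ?mulr_ge0 ?(le_trans y0 yz) ?(ltW c0) //.
  by rewrite ler_pM2l.
by apply: le_trans cb _; rewrite ler_pM2l // lerXn2r // nnegrE (le_trans y0).
Qed.

(* Multiplying the n-th power by y^n or y^-n moves it into the smaller
   interval. *)
Lemma near_power_sqr (K : realFieldType) n (b y : K) : 0 < b -> 1 <= y ->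
  near_power n b (y ^+ 2) -> near_power n b y.
Proof.
move=> b0 y1 [c [c0 [bc cb]]].
have y0 : 0 < y by apply: lt_le_trans y1.
have yn1 : 1 <= y ^+ n by exact: exprn_ege1.
have yn0 : 0 < y ^+ n by exact: exprn_gt0.
case: (lerP b ((c * y) ^+ n)) => [bcy|/ltW cyb]; last first.
  exists (c * y); split; first exact: mulr_gt0.
  split; first by rewrite -mulrA -expr2.
  by apply: le_trans cyb _; rewrite ler_peMr // ltW.
case: (lerP (c ^+ n) (b * y ^+ n)) => [cby|/ltW bcy']; first by exists c.
exists (c / y); split; first exact: divr_gt0.
split; first by rewrite divfK ?gt_eqF // (le_trans _ bcy') // ler_peMr // ltW.
by rewrite exprMn exprVn ler_pdivrMr // -mulrA -exprD addnn -mul2n exprM.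
Qed.

(** As [m <= 2 ^ (2 ^ m)], taking square roots of the bound [m] times brings it down to 2. *)
Lemma near_power_nat (K : realFieldType) n (b : K) (m : nat) : 0 < b ->
  near_power n b m%:R -> near_power n b 2.
Proof.
move=> b0 bm; have : near_power n b (2 ^+ (2 ^ m)).
  apply: near_power_le bm => //; rewrite -natrX ler_nat.
  by rewrite (leq_trans (ltnW (ltn_expl m (ltnSn 1)))) // ltnW // ltn_expl.
elim: m {bm} => // m IH; rewrite expnSr exprM => /near_power_sqr h.
by apply/IH/h => //; rewrite exprn_ege1 // ler1n.
Qed.

(** * Formulas of the language of ordered rings *)

Definition FLe (t u : or_term) : formula or_term := FNot (FLt u t).
Definition FOr (T : Type) (f g : formula T) := FNot (FAnd (FNot f) (FNot g)).
Definition FAll (T : Type) (f : formula T) := FNot (FEx (FNot f)).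

Fixpoint or_shift (t : or_term) : or_term :=
  match t with
  | OrVar i => OrVar i.+1
  | OrZero => OrZero
  | OrOne => OrOne
  | OrOpp t1 => OrOpp (or_shift t1)
  | OrAdd t1 t2 => OrAdd (or_shift t1) (or_shift t2)
  | OrMul t1 t2 => OrMul (or_shift t1) (or_shift t2)
  end.

Definition or_pow (t : or_term) (n : nat) := iter n (OrMul t) OrOne.

Definition near_power_formula (n : nat) (b y : or_term) : formula or_term :=
  FEx (FAnd (FLt OrZero (OrVar 0))
    (FAnd (FLe (or_shift b) (or_pow (OrMul (OrVar 0) (or_shift y)) n))
          (FLe (or_pow (OrVar 0) n) (OrMul (or_shift b) (or_pow (or_shift y) n))))).

(** Under the quantifier over [b] the tested element has index 1; its square stands in for its
    absolute value. *)
Definition core_ring_formula (n : nat) : formula or_term :=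
  let x2 := OrMul (OrVar 1) (OrVar 1) in
  FAll (FOr (FNot (FLt OrZero (OrVar 0)))
       (FOr (near_power_formula n (OrVar 0) (OrAdd OrOne OrOne))
       (FOr (FLe x2 OrOne) (FNot (near_power_formula n (OrVar 0) x2))))).

(** The quotient of [s] by [t] is named by a new variable 0. In [holds_ratio] the formula [f] looks
    at that variable only, hence needs no renaming. *)
Definition ratio_formula (f : formula or_term) (s t : or_term) :=
  FEx (FAnd (FEq (OrMul (OrVar 0) (or_shift t)) (or_shift s)) f).

Section Formulas.
Variable K : realFieldType.
Implicit Types (a : nat -> K) (f : formula or_term).

Lemma or_eval_shift a x t : or_eval (push x a) (or_shift t) = or_eval a t.
Proof. by elim: t => //= [t ->|t -> u ->|t -> u ->]. Qed.

Lemma or_eval_pow a t n : or_eval a (or_pow t n) = or_eval a t ^+ n.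
Proof. by elim: n => //= n ->; rewrite exprS. Qed.

Lemma holds_le a t u :
  holds (or_eval (K:=K)) a (FLe t u) <-> or_eval a t <= or_eval a u.
Proof. by rewrite /= ; split=> [/negP|]; rewrite leNgt // => /negP. Qed.

Lemma holds_and a f g : holds (or_eval (K:=K)) a (FAnd f g) <->
  holds (or_eval (K:=K)) a f /\ holds (or_eval (K:=K)) a g.
Proof. by []. Qed.

Lemma holds_not a f :
  holds (or_eval (K:=K)) a (FNot f) <-> ~ holds (or_eval (K:=K)) a f.
Proof. by []. Qed.

Lemma holds_or a f g : holds (or_eval (K:=K)) a (FOr f g) <->
  holds (or_eval (K:=K)) a f \/ holds (or_eval (K:=K)) a g.
Proof. by rewrite /= -not_orE notK. Qed.

Lemma holds_all a f : holds (or_eval (K:=K)) a (FAll f) <->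
  forall x, holds (or_eval (K:=K)) (push x a) f.
Proof.
by split=> [/= nf x|fx /= [x]//]; apply: contrapT => nfx; apply: nf; exists x.
Qed.

Lemma holds_near_power a n b y :
  holds (or_eval (K:=K)) a (near_power_formula n b y) <->
  near_power n (or_eval a b) (or_eval a y).
Proof.
have E c : holds (or_eval (K:=K)) (push c a) (FAnd (FLt OrZero (OrVar 0))
    (FAnd (FLe (or_shift b) (or_pow (OrMul (OrVar 0) (or_shift y)) n))
      (FLe (or_pow (OrVar 0) n) (OrMul (or_shift b) (or_pow (or_shift y) n))))) <->
    0 < c /\ or_eval a b <= (c * or_eval a y) ^+ n /\
      c ^+ n <= or_eval a b * or_eval a y ^+ n.
  by rewrite !holds_and !holds_le /= !or_eval_pow /= !or_eval_shift.
by split=> -[c /E Ec]; exists c.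
Qed.

Lemma holds_core_ring a n : holds (or_eval (K:=K)) a (core_ring_formula n) <->
  forall b, 0 < b -> ~ near_power n b 2 ->
    a 0%N ^+ 2 <= 1 \/ ~ near_power n b (a 0%N ^+ 2).
Proof.
rewrite holds_all; have E b : holds (or_eval (K:=K)) (push b a) (FOr
    (FNot (FLt OrZero (OrVar 0)))
    (FOr (near_power_formula n (OrVar 0) (OrAdd OrOne OrOne))
    (FOr (FLe (OrMul (OrVar 1) (OrVar 1)) OrOne)
      (FNot (near_power_formula n (OrVar 0) (OrMul (OrVar 1) (OrVar 1))))))) <->
    (0 < b -> ~ near_power n b 2 ->
      a 0%N ^+ 2 <= 1 \/ ~ near_power n b (a 0%N ^+ 2)).
  rewrite !holds_or (holds_le _ (OrMul _ _)) !holds_not !holds_near_power /=.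
  split; first by move=> [|[|[]]] // h _ _; [left|right].
  have [b0|nb0] := pselect (0 < b); last by left.
  have [b2|nb2] := pselect (near_power n b 2); first by right; left.
  by move=> /(_ b0 nb2) h; right; right; case: h; [left|right].
by split=> fb b; [apply/E/fb|apply/E/fb].
Qed.

Lemma holds_ratio (A : set K) f s t a :
  (forall a, A (a 0%N) <-> holds (or_eval (K:=K)) a f) -> or_eval a t != 0 ->
  holds (or_eval (K:=K)) a (ratio_formula f s t) <-> A (or_eval a s / or_eval a t).
Proof.
move=> fA t0; split=> [[x /= [+ /fA Ax]]|Ast].
  by rewrite !or_eval_shift => <-; rewrite mulfK.
exists (or_eval a s / or_eval a t); split; last exact/fA.
by rewrite /= !or_eval_shift divfK.
Qed.

End Formulas.

(** * The valuation ring of the divisible core *)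

Section CoarseningDefinable.
Variables (K : realFieldType) (G : orderedZmodType) (v : K -> G).
Implicit Types (L : set G) (a : nat -> K).

(** If [v x] is in the core and [c ^+ n] is near [b], then [v b - v c *+ n] is in the core, so [v b]
    is the value of an [n]-th power and [b] is within an integer factor of it. If [x] is outside the
    ring, a non-multiple of [n] between 0 and [- v x] is the value of a [b] violating the
    condition. *)
Lemma core_ringP n x : natural_valuation v -> (0 < n)%N ->
  coarsening_ring v (divisible_core n) x <->
  forall b, 0 < b -> ~ near_power n b 2 ->
    x ^+ 2 <= 1 \/ ~ near_power n b (x ^+ 2).
Proof.
move=> nv n0; have hv := nv.1; have vM := valuationM hv.1.
have HL := divisible_core_convex G n.
have [->|x0] := eqVneq x 0.
  by split=> _; [move=> b _ _; left; rewrite expr0n|left].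
have x20 : 0 < x ^+ 2 by rewrite exprn_even_gt0 // x0 orbT.
have x2n0 : 0 < (x ^+ 2) ^+ n by exact: exprn_gt0.
have vx2n : v ((x ^+ 2) ^+ n) = v x *+ (2 * n).
  by rewrite -exprM valuationX.
split=> [|near].
  move=> [/eqP|xL b b0 nb2]; first by rewrite (negbTE x0).
  case: (lerP (x ^+ 2) 1) => [x21|/ltW x21]; [by left|right].
  have vx0 : v x *+ 2 <= 0 by rewrite -valuationX // -(valuation1 hv) valuation_le.
  case: xL => [vx|Lx].
    have := le_trans (ozmod_le_mulrn (isT : (0 < 2)%N) (ltW vx)) vx0.
    by move=> /(lt_le_trans vx); rewrite ltxx.
  move=> [c [c0 [bc cb]]]; apply: nb2.
  have [c0' b0'] : c != 0 /\ b != 0 by rewrite !gt_eqF.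
  have Lx2n : divisible_core n (v x *+ (2 * n)).
    exact: (subgroupMz (2 * n)%N HL Lx).
  have [h Lh hE] : exists2 h, divisible_core n h & h *+ n = v b - v c *+ n.
    apply: divisible_core_div => //.
    apply: (subgroup_convex HL Lx2n (subgroupN HL Lx2n)).
      have := valuation_le hv b0 bc.
      rewrite exprMn vM ?expf_neq0 // vx2n valuationX //.
      by rewrite ozmod_leBrDr addrC.
    have := valuation_le hv (exprn_gt0 n c0) cb.
    rewrite vM ?expf_neq0 // vx2n valuationX //.
    by move=> vcb; rewrite ozmod_leBlDr addrC ozmod_leBrDr.
  have [d d0 vd] := valuation_onto_pos hv (v c + h).
  have dn0 : 0 < d ^+ n by exact: exprn_gt0.
  have vbd : v b = v (d ^+ n).
    by rewrite valuationX ?gt_eqF // vd mulrnDl hE addrC subrK.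
  have vq y z : 0 < y -> 0 < z -> v y = v z -> exists m : nat, y <= z * m%:R.
    move=> y0 z0 vyz; have [|m] := @natural_valuation_bounded _ _ v (y / z) nv.
      by rewrite vM ?invr_eq0 ?gt_eqF // valuationV ?gt_eqF // vyz subrr.
    rewrite gtr0_norm ?divr_gt0 // => yzm; exists m.
    by rewrite mulrC -ler_pdivrMr.
  have [m1 bd] := vq _ _ b0 dn0 vbd.
  have [m2 db] := vq _ _ dn0 b0 (esym vbd).
  apply: (@near_power_nat _ _ _ (m1 + m2).+1) => //; exists d; split=> //.
  (* The successor keeps the base positive, so its [n]-th power bounds both [m1] and [m2]. *)
  have mX (m : nat) : (m <= m1 + m2)%N -> m%:R <= (m1 + m2).+1%:R ^+ n :> K.
    move=> mm; rewrite -natrX ler_nat; apply: (@leq_trans (m1 + m2).+1).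
      exact: leqW.
    by rewrite -{1}(expn1 (m1 + m2).+1) leq_pexp2l.
  split; first by rewrite exprMn (le_trans bd) // ler_pM2l // mX // leq_addr.
  by rewrite (le_trans db) // ler_pM2l // mX // leq_addl.
apply: contrapT => /not_orP[_ /not_orP[/negP + nL]].
rewrite ozmod_ltNge negbK => vx0.
have vxneg : ~ 0 <= v x.
  move=> vx0'; apply: nL; rewrite (_ : v x = 0); first exact: subgroup0.
  by apply/le_anti; rewrite vx0.
move: nL => /existsNP[d /not_implyP[d0 /not_implyP[dx /forallNP nd]]].
have {}dx : d <= - v x.
  by case: dx => // dx; case: (vxneg); exact: le_trans dx.
have [b b0 vb] := valuation_onto_pos hv d.
have [|x21|] := near b b0.
- move=> [c [c0 [bc cb]]]; apply: (nd (v c)).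
  have v2n : v (2 ^+ n) = 0.
    by rewrite valuationX ?pnatr_eq0 // valuation2 // mul0rn.
  have [c0' b0'] : c != 0 /\ b != 0 by rewrite !gt_eqF.
  have n20 : 2 ^+ n != 0 :> K by rewrite expf_neq0 ?pnatr_eq0.
  apply/le_anti/andP; rewrite -vb; split.
    have := valuation_le hv b0 bc.
    by rewrite exprMn vM ?expf_neq0 ?pnatr_eq0 // v2n addr0 valuationX.
  have := valuation_le hv (exprn_gt0 n c0) cb.
  by rewrite vM ?expf_neq0 ?pnatr_eq0 // v2n addr0 valuationX.
- apply: vxneg; apply: (@ozmod_mulrn_ge0_inv _ _ 2) => //.
  by rewrite -valuationX // -(valuation1 hv) valuation_le.
(* The power 1 lies in the large interval around [b], since [0 <= v b <= - v x]. *)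
apply; exists 1; rewrite ltr01 mul1r expr1n; split=> //; split.
  case: (lerP b ((x ^+ 2) ^+ n)) => // /ltW/(valuation_le hv x2n0); rewrite vb vx2n.
  move=> /(le_trans d0)/ozmod_mulrn_ge0_inv => h.
  by case: vxneg; apply: h; rewrite muln_gt0.
case: (lerP 1 (b * (x ^+ 2) ^+ n)) => // /ltW/(valuation_le hv (mulr_gt0 b0 x2n0)).
rewrite vM ?gt_eqF // valuation1 // vb vx2n => dx2n; case: vxneg.
(* Now [0 <= v x *+ (2 * n - 1)], with a positive multiplier because [n > 0]. *)
have := le_trans dx2n (ozmod_leD dx (lexx _)).
case: (n) n0 => // k _; rewrite mulnS addSn mulrS addKr.
by move=> /ozmod_mulrn_ge0_inv; exact.
Qed.

End CoarseningDefinable.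

(* A pair of field terms whose quotient has the value of the group term, since
   the field language has no inverse. *)
Fixpoint og_fraction (t : og_term) : or_term * or_term :=
  match t with
  | OgVar i => (OrVar i, OrOne)
  | OgZero => (OrOne, OrOne)
  | OgOpp t1 => let p := og_fraction t1 in (p.2, p.1)
  | OgAdd t1 t2 => let p := og_fraction t1 in let q := og_fraction t2 in
                   (OrMul p.1 q.1, OrMul p.2 q.2)
  end.

(** * Interpretation of G / L in the field *)

Section ResidueDefinable.
Variables (K : realFieldType) (G : orderedZmodType) (v : K -> G) (L : set G).
Hypothesis hv : convex_valuation v.
Hypothesis HL : convex_subgroup L.
Variable f : formula or_term.
Hypothesis Lf : forall a : nat -> K,
  coarsening_ring v L (a 0%N) <-> holds (or_eval (K:=K)) a f.

(** Predicates are pulled back along [v] to assignments without zeros, where every value is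
    meaningful; surjectivity of [v] reaches all group assignments. *)
Definition residue_definable (P : (nat -> G) -> Prop) : Prop :=
  (forall e e', (forall i, L (e i - e' i)) -> P e -> P e') /\
  exists h : formula or_term, forall a : nat -> K, (forall i, a i != 0) ->
    P (v \o a) <-> holds (or_eval (K:=K)) a h.

Lemma og_fractionP (a : nat -> K) t : (forall i, a i != 0) ->
  let x := or_eval a (og_fraction t).1 in let y := or_eval a (og_fraction t).2 in
  [/\ x != 0, y != 0 & og_eval (v \o a) t = v x - v y].
Proof.
move=> a0; have vM := valuationM hv.1; have v1 := valuation1 hv.
elim: t => [i||t [x0 y0 IH]|t [x0 y0 IHt] u [z0 w0 IHu]] /=.
- by rewrite oner_neq0 v1 subr0; split.
- by rewrite oner_neq0 v1 subr0; split.
- by split=> //; rewrite IH opprB.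
- by split; rewrite ?mulf_neq0 // !vM // IHt IHu opprD addrACA.
Qed.

Lemma coarsening_ring_ratio (x y : K) : x != 0 -> y != 0 ->
  coarsening_ring v L (x / y) <-> 0 < v x - v y \/ L (v x - v y).
Proof.
move=> x0 y0; rewrite -(valuationV hv) // -(valuationM hv.1) ?invr_eq0 //.
split=> [[/eqP|//]|]; last by right.
by rewrite mulf_eq0 invr_eq0 (negbTE x0) (negbTE y0).
Qed.

Lemma og_eval_residue e e' t : (forall i, L (e i - e' i)) ->
  L (og_eval e t - og_eval e' t).
Proof.
move=> Lee'; elim: t => [i||t IH|t IHt u IHu] /=; first exact: Lee'.
- by rewrite subrr; exact: subgroup0.
- by rewrite -opprD; exact: subgroupN.
- by rewrite opprD addrACA; exact: subgroupD.
Qed.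

Lemma subgroup_residue g h : L (g - h) -> L g -> L h.
Proof. by move=> Lgh Lg; have := subgroupB HL Lg Lgh; rewrite subKr. Qed.

(** Quantifiers over [G] become quantifiers over nonzero field elements. A value is in [L] when the
    quotient and its inverse are both in the ring, and positive outside [L] when only the quotient
    is. *)
Lemma residue_definable_class : residue_class L residue_definable.
Proof.
have symL (e e' : nat -> G) :
      (forall i, L (e i - e' i)) -> forall i, L (e' i - e i).
  by move=> ee' i; rewrite -opprB; exact: subgroupN.
split.
- by move=> P [].
- move=> P Q PQ [inv [h Ph]]; split=> [e e' ee' /PQ/(inv _ _ ee')/PQ//|].
  by exists h => a a0; rewrite -PQ Ph.
- move=> P [inv [h Ph]]; split=> [e e' ee' nP /(inv _ _ (symL _ _ ee'))//|].
  by exists (FNot h) => a a0; rewrite Ph.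
- move=> P Q [invP [h Ph]] [invQ [k Qk]]; split.
    by move=> e e' ee' [/(invP _ _ ee') Pe' /(invQ _ _ ee') Qe'].
  by exists (FAnd h k) => a a0; rewrite Ph // Qk.
- move=> P [inv [h Ph]]; split.
    move=> e e' ee' [g Pg]; exists g; apply: inv Pg => -[|i] //=.
    by rewrite subrr; exact: subgroup0.
  exists (FEx (FAnd (FNot (FEq (OrVar 0) OrZero)) h)) => a a0.
  have vpush x : v \o push x a = push (v x) (v \o a) by apply/funext => -[].
  have push0 x : x != 0 -> forall i, push x a i != 0 by move=> x0 [].
  split=> [[g Pg]|[x [/= /eqP x0 hx]]].
    have [x x0 xg] := valuation_onto hv.1 g.
    exists x; split=> /=; first exact/eqP.
    by apply/Ph; [exact: push0|rewrite vpush xg].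
  by exists (v x); rewrite -vpush; apply/Ph => //; exact: push0.
- move=> t; split=> [e e' ee'|]; first exact/subgroup_residue/og_eval_residue.
  exists (FAnd (ratio_formula f (og_fraction t).1 (og_fraction t).2)
               (ratio_formula f (og_fraction t).2 (og_fraction t).1)) => a a0.
  have [x0 y0 ->] := og_fractionP t a0.
  rewrite holds_and !(holds_ratio _ Lf) // !coarsening_ring_ratio //.
  rewrite -(opprB (v (or_eval a (og_fraction t).1))).
  set g := _ - _; split=> [Lg|[[g0|//] [Ng0|]]].
  + by split; right => //; exact: subgroupN.
  + by case: (ozmod_oppr_gt0 g0).
  + by move=> /(subgroupN HL); rewrite opprK.
- move=> t; split=> [e e' ee' [e0 nLe]|].
    have Lee' := og_eval_residue t ee'; split; last first.
      move=> Le'; apply: nLe; apply: subgroup_residue Le'.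
      by rewrite -opprB; exact: subgroupN.
    (* Otherwise the value at [e] lies between 0 and the difference of the two values, hence in
       [L]. *)
    rewrite ozmod_ltNge; apply/negP => e'0; apply: nLe.
    apply: (subgroup_convex HL (subgroup0 HL) Lee' (ltW e0)).
    by rewrite ozmod_leBrDr -{2}[og_eval e t]addr0; exact: ozmod_leD2l.
  exists (FAnd (ratio_formula f (og_fraction t).1 (og_fraction t).2)
         (FNot (ratio_formula f (og_fraction t).2 (og_fraction t).1))) => a a0.
  have [x0 y0 ->] := og_fractionP t a0.
  rewrite holds_and holds_not !(holds_ratio _ Lf) // !coarsening_ring_ratio //.
  rewrite -(opprB (v (or_eval a (og_fraction t).1))).
  set g := _ - _; split=> [[g0 nLg]|[gL nNg]].
    split; first by left.
    case=> [Ng0|/(subgroupN HL)]; last by rewrite opprK.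
    exact: (ozmod_oppr_gt0 g0).
  have nLg : ~ L g by move=> Lg; apply: nNg; right; exact: subgroupN.
  by case: gL.
Qed.

End ResidueDefinable.

(** Otherwise [H] would be divisible, since by convexity it contains the quotients of its elements,
    and maximality would give [H = G0]. *)
Lemma not_divisible_core (G : orderedZmodType) (G0 H : set G) :
  maximal_divisible_convex G0 -> convex_subgroup H -> G0 `<` H ->
  exists (n : nat) (h : G), [/\ (0 < n)%N, H h & forall g, g *+ n <> h].
Proof.
move=> [_ _ G0max] HH [G0H nHG0]; apply: contrapT => none; apply: nHG0.
have -> // : H = G0.
apply: G0max => // n h n0 Hh.
have [g gh] : exists g, g *+ n = h.
  apply: contrapT => /forallNP nh; apply: none.
  by exists n, h; split.
exists g => //.
have NHh := subgroupN HH Hh; have H0 := subgroup0 HH.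
case: (ozmod_leP 0 g) => g0.
  by apply: (subgroup_convex HH H0 Hh g0); rewrite -gh ozmod_le_mulrn.
apply: (subgroup_convex HH Hh H0 _ g0).
by rewrite -gh -ozmod_leN2 -mulNrn ozmod_le_mulrn // -ozmod_leN0 opprK.
Qed.

Theorem theorem5p3 (K : realFieldType) (G : orderedZmodType) (v : K -> G)
    (G0 H : set G) :
  natural_valuation v ->
  maximal_divisible_convex G0 ->
  convex_subgroup H ->
  og_definable H ->
  G0 `<` H ->
  or_definable (coarsening_ring v H).
Proof.
move=> nv G0max HH [f [e Hf]] G0H; have hv := nv.1.
have [n [h [n0 Hh nh]]] := not_divisible_core G0max HH G0H.
have [N N0 HN] := definable_residue G f.
(* The factor [N] makes [L] divisible enough for the elimination; the factor [n] forces [L] into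
   [H]. *)
pose m := (N * n)%N; have m0 : (0 < m)%N by rewrite muln_gt0 N0.
pose L : set G := divisible_core m.
have HL : convex_subgroup L := divisible_core_convex G m.
have LH : L `<=` H.
  apply: (divisible_core_sub HH Hh) => g; rewrite /m mulrnA => gh.
  exact: nh gh.
have HD : residue_class L (residue_definable v L).
  apply: (residue_definable_class hv HL (f := core_ring_formula m)) => a.
  by rewrite core_ringP // holds_core_ring.
have [P DP HP] : exists2 P, residue_definable v L P &
    forall g, H g <-> P (push g e).
  apply: (HN L) => //.
    apply: mul_divisible_dvd (divisible_core_div m0) => //.
    exact: dvdn_mulr.
  by move=> g l Hg Ll; apply: subgroupD => //; exact: LH.
(* Positivity is only available outside [L], but positive values in [L] already lie in [H]. *)
have [_ [k Qk]] := residue_or HD (residue_pos HD (OgVar 0)) DP.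
have /choice[a av] : forall i, exists x, x != 0 /\ v x = e i.
  by move=> i; have [x x0 xe] := valuation_onto hv.1 (e i); exists x.
(* Zero is added by hand, as [k] is correct only on assignments without zeros. *)
exists (FOr (FEq (OrVar 0) OrZero) k), a => x; rewrite holds_or /=.
have [->|x0] := eqVneq x 0; first by split; left.
have pa i : push x a i != 0 by case: i => [|i] //=; exact: (av i).1.
have vpa : v \o push x a = push (v x) e.
  by apply/funext => -[|i] //=; exact: (av i).2.
rewrite -(Qk _ pa) vpa /= -HP; split=> [[|[vx|Hx]]|[/eqP|[[vx _]|Hx]]].
- by move/eqP; rewrite (negbTE x0).
- have [Lx|nLx] := pselect (L (v x)); right; last by left.
  by right; exact: LH.
- by right; right.
- by rewrite (negbTE x0).
- by right; left.
- by right; right.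
Qed.
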